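(* Let $r$ and $s$ be integers each of which is positive or odd. Then for every integer $n\ge0$ with $n\ne-(r+s)/2$ and all integers $\alpha,\beta$ with $0\le\alpha,\beta\le n$, $$\delta_{\alpha+\beta,n-1}+\sum_{\substack{\ell\ge\alpha,\ m\ge\beta\\ \ell+m=n}}b_r(\ell,\alpha)\,b_s(m,\beta)=\sum_{k=0}^n b_{r+s}(n,k)\Big(b_r(k-\beta,\alpha)+b_s(k-\alpha,\beta)\Big).$$
   Context: $\delta_{i,j}$ is the Kronecker delta and $B_j$ are the Bernoulli numbers, $\frac{t}{e^t-1}=\sum_j B_j\frac{t^j}{j!}$. For $q\in\mathbb{Z}$, integers $n\ge0$ with $n\ne -q/2$, and $0\le i\le n$, define $$b_q(n,i):=\begin{cases}\frac{2}{2n+q}\binom{2n+q}{2i+q}B_{2(n-i)}, & n\ge\max\{0,\lfloor -q/2\rfloor+1\},\\ \frac{2}{2i+q}\binom{-2i-q}{-2n-q}B_{2(n-i)}, & 0\le n\le\lfloor-(q+1)/2\rfloor,\end{cases}$$ with $\binom{N}{j}=0$ for $j<0$; and set $b_q(n,i):=0$ whenever $n<0$ or $i>n$. (The paper denotes $b_q(n,i)$ by ${n\brack i}_q$.) *)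

(* Defs.v *)
From mathcomp Require Import all_boot all_order all_algebra.
Set Implicit Arguments. Unset Strict Implicit. Unset Printing Implicit Defensive.
Import Order.TTheory GRing.Theory Num.Theory.
Local Open Scope ring_scope.

(* Bernoulli numbers (convention B_1 = -1/2, i.e. t/(e^t-1) = sum B_j t^j/j!),
   via the standard recursion equivalent to the generating function:
   B_0 = 1,  sum_{k=0}^{m} C(m+1,k) B_k = 0 for m >= 1. *)
Fixpoint bern_list (m : nat) : seq rat :=
  match m with
  | 0 => [:: 1]
  | m'.+1 =>
      let l := bern_list m' in
      rcons l (- (\sum_(k < m'.+1) ('C(m'.+2, k))%:R * nth 0 l k) / (m'.+2)%:R)
  end.

Definition bernoulli (m : nat) : rat := nth 0 (bern_list m) m.

(* binomial coefficient with integer arguments, used only with N >= 0;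
   it is 0 for j < 0 (and, by convention, for N < 0). *)
Definition binz (N j : int) : rat :=
  if (0 <= j) && (0 <= N) then ('C(`|N|%N, `|j|%N))%:R else 0.

(* b_q(n,i) = [n brack i]_q ; defined to be 0 outside the paper's domain
   (n < 0, i > n, i < 0, or 2n + q = 0). *)
Definition bq (q n i : int) : rat :=
  if (n < 0) || (i < 0) || (n < i) then 0
  else if (Num.max 0 (((- q) %/ 2)%Z + 1) <= n) then
    2 / (2 * n + q)%:~R * binz (2 * n + q) (2 * i + q)
      * bernoulli (2 * `|n - i|%N)%N
  else if (n <= ((- (q + 1)) %/ 2)%Z) then
    2 / (2 * i + q)%:~R * binz (- 2 * i - q) (- 2 * n - q)
      * bernoulli (2 * `|n - i|%N)%N
  else 0.

(* Main.v *)
Require Import Defs.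
From mathcomp Require Import all_boot all_order all_algebra.
From mathcomp Require Import ring lra zify.
Import Order.TTheory GRing.Theory Num.Theory.
Local Open Scope ring_scope.

(** Whenever [2n+q] and [2i+q] are nonzero, with [d = n - i] and generalized
    binomial coefficients,
    [b_q(n,i) = 2/(2n+q) C(2n+q, 2d) B_{2d} = 2/(2i+q) C(-(2i+q), 2d) B_{2d}].
    Put [x = -(2 alpha + r)], [y = -(2 beta + s)], [N = n - alpha - beta]; after
    multiplication by [x y (x + y - 2N)] the claim is a polynomial identity in
    [x] and [y].  For natural numbers [x, y > 2N] it compares the coefficients
    of [X^(x + y - 2N)] in Nielsen's formula, which expands the product of
    Bernoulli polynomials [B_x(X) B_y(X)] in Bernoulli polynomials up to a
    constant; that formula holds because both sides have the same forward
    difference. *)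

(** * Bernoulli numbers and their recursion *)

Lemma size_bern_list m : size (bern_list m) = m.+1.
Proof. by elim: m => [|m IH] //=; rewrite size_rcons IH. Qed.

Lemma nth_bern_list m k : (k <= m)%N -> nth 0 (bern_list m) k = bernoulli k.
Proof.
elim: m => [|m IH]; first by case: k.
rewrite leq_eqVlt => /predU1P[->//|lt_km].
by rewrite /= nth_rcons size_bern_list lt_km IH.
Qed.

Lemma bernoulliS m :
  bernoulli m.+1 = - (\sum_(k < m.+1) 'C(m.+2, k)%:R * bernoulli k) / m.+2%:R.
Proof.
rewrite /bernoulli /= nth_rcons size_bern_list ltnn eqxx.
congr (- _ / _); apply: eq_bigr => k _.
by rewrite nth_bern_list // -ltnS.
Qed.

Lemma bernoulli0 : bernoulli 0 = 1. Proof. by []. Qed.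

Lemma bernoulli1 : bernoulli 1 = - 2^-1.
Proof. by rewrite bernoulliS big_ord1 bin0 bernoulli0 mulr1 mulN1r. Qed.

(** For [m >= 2] the recursion makes all terms but the last cancel. The sum is the value at 1 of the
    [m]-th Bernoulli polynomial. *)
Lemma sum_bin_bernoulli m :
  \sum_(k < m.+1) 'C(m, k)%:R * bernoulli k = bernoulli m + (m == 1)%:R.
Proof.
case: m => [|[|m]].
- by rewrite big_ord1 bin0 mul1r addr0.
- by rewrite big_ord_recr big_ord1 /= bin0 binn bernoulli0; ring.
- rewrite big_ord_recr /= binn mul1r big_ord_recr /= bernoulliS.
  rewrite (_ : 'C(m.+2, m.+1) = m.+2); last by rewrite -bin_sub // subSnn bin1.
  by rewrite mulrCA mulfV ?pnatr_eq0 // mulr1 subrr add0r addr0.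
Qed.

(** * Polynomials determined by values, periodicity or derivative *)

Lemma poly_eq0_nat (P : {poly rat}) n0 :
  (forall n, (n0 <= n)%N -> P.[n%:R] = 0) -> P = 0.
Proof.
move=> P0; apply/eqP; case: (eqVneq P 0) => // nzP.
(* As many distinct roots as [size P], one more than the degree allows. *)
pose s : seq rat := [seq i%:R | i <- iota n0 (size P)].
have := @max_poly_roots _ P s nzP.
rewrite size_map size_iota ltnn => -> //.
  by apply/allP => x /mapP[i]; rewrite mem_iota => /andP[/P0 i0 _] ->; apply/eqP.
by rewrite map_inj_uniq ?iota_uniq // => i j /eqP; rewrite eqr_nat => /eqP.
Qed.

Lemma poly_periodic (P : {poly rat}) :
  (forall x, P.[x + 1] = P.[x]) -> P = P.[0]%:P.
Proof.
move=> per; apply/eqP; rewrite -subr_eq0; apply/eqP.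
apply: (@poly_eq0_nat _ 0) => n _; rewrite !hornerE.
by elim: n => [|n IH]; rewrite ?subrr // -natr1 per.
Qed.

Lemma deriv_eq0 (P : {poly rat}) : P^`() = 0 -> P = P.[0]%:P.
Proof.
move=> P'0; apply/polyP => -[|i]; rewrite coefC ?horner_coef0 //=.
have /eqP := congr1 (fun Q : {poly rat} => Q`_i) P'0.
by rewrite coef_deriv coef0 mulrn_eq0 => /eqP.
Qed.

(** * Bernoulli polynomials and the vanishing of odd Bernoulli numbers *)

Definition bernoulli_poly (m : nat) : {poly rat} :=
  \sum_(i < m.+1) ('C(m, i)%:R * bernoulli i) *: 'X^(m - i).

Lemma bernoulli_poly_at0 m : (bernoulli_poly m).[0] = bernoulli m.
Proof.
rewrite horner_sum big_ord_recr /= big1 ?add0r => [|i _].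
  by rewrite subnn !hornerE binn mul1r.
by rewrite !hornerE expr0n subn_eq0 leqNgt ltn_ord mulr0.
Qed.

Lemma bernoulli_poly_at1 m :
  (bernoulli_poly m).[1] = bernoulli m + (m == 1)%:R.
Proof.
rewrite horner_sum -sum_bin_bernoulli; apply: eq_bigr => i _.
by rewrite !hornerE expr1n mulr1.
Qed.

Lemma deriv_bernoulli_poly m :
  (bernoulli_poly m.+1)^`() = m.+1%:R *: bernoulli_poly m.
Proof.
rewrite /bernoulli_poly big_ord_recr /= subnn derivD raddf_sum.
rewrite derivZ derivXn mulr0n scaler0 addr0 scaler_sumr.
apply: eq_bigr => i _; have le_im : (i <= m)%N by rewrite -ltnS.
rewrite /= derivZ derivXn -scaler_nat !scalerA subSn //=.
congr (_ *: _); rewrite mulrAC mulrA; congr (_ * _).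
by rewrite -!natrM mulnC -subSn // -mul_bin_down.
Qed.

(** Induction on [m]: the defect [D m.+1] has derivative [m.+1 * D m = 0], so it is constant, and
    the values of the Bernoulli polynomials at 0 and 1 show that it vanishes at 0. *)
Lemma bernoulli_polyD1 m x :
  (bernoulli_poly m).[x + 1] = (bernoulli_poly m).[x] + m%:R * x ^+ m.-1.
Proof.
pose D k : {poly rat} :=
  bernoulli_poly k \Po ('X + 1) - bernoulli_poly k - k%:R *: 'X^(k.-1).
suff D0 : D m = 0.
  have := congr1 (fun P : {poly rat} => P.[x]) D0.
  by rewrite /D !hornerE horner_comp !hornerE => /eqP; rewrite -addrA -opprD subr_eq0 => /eqP.
elim: m => [|m IH].
  have -> : D 0%N = 1%:P \Po ('X + 1) - 1.
    by rewrite /D /bernoulli_poly big_ord1 subnn expr0 scale0r subr0 mul1r !scale1r.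
  by rewrite comp_polyC subrr.
have/deriv_eq0-> : (D m.+1)^`() = 0.
  rewrite /D !derivB deriv_comp derivZ derivXn deriv_bernoulli_poly.
  rewrite derivD derivX derivC addr0 mulr1 linearZ /=.
  by rewrite -scaler_nat -!scalerBr -/(D m) IH scaler0.
rewrite /D !hornerE horner_comp !hornerE bernoulli_poly_at1 bernoulli_poly_at0.
rewrite [bernoulli _ + _]addrC addrK expr0n eqSS.
by case: m {IH} => [|m] /=; rewrite ?mulr0 ?mulr1 subrr.
Qed.

(** The difference [B_{m+1}(1 - X) - B_{m+1}(X)] is periodic for odd [m], hence constant. Its
    derivative at 0 is [-2 (m+1) B_m] when [m] is not 1. *)
Lemma bernoulli_odd m : odd m -> m != 1%N -> bernoulli m = 0.
Proof.
move=> odd_m m_neq1.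
pose P := bernoulli_poly m.+1 \Po (1 - 'X) - bernoulli_poly m.+1.
have/poly_periodic Pc x : P.[x + 1] = P.[x].
  rewrite !hornerE !horner_comp !hornerE bernoulli_polyD1.
  have := bernoulli_polyD1 m.+1 (- x); rewrite addrC => ->.
  rewrite opprD addrCA subrr addr0 /= exprNn -signr_odd odd_m; ring.
have := congr1 (fun Q : {poly rat} => Q^`().[0]) Pc.
rewrite /= derivC derivB deriv_comp deriv_bernoulli_poly derivB derivX derivC.
rewrite sub0r mulrN1 !hornerE horner_comp !hornerE.
rewrite bernoulli_poly_at1 bernoulli_poly_at0 (negbTE m_neq1) addr0.
move=> /eqP; rewrite -opprD oppr_eq0.
by rewrite -mulr2n mulrn_eq0 /= mulf_eq0 pnatr_eq0 => /eqP.
Qed.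

(** * Parity splitting, and coefficients counted from the top degree *)

Lemma big_ord_parity (R : nmodType) (F : nat -> R) N :
  \sum_(i < (2 * N).+1) F i
    = \sum_(i < N.+1) F (2 * i)%N + \sum_(i < N) F (2 * i).+1.
Proof.
elim: N => [|N IH]; first by rewrite big_ord0 addr0 !big_ord1.
have e2 : (2 * N.+1 = (2 * N).+2)%N by rewrite mulnS.
rewrite [in LHS]e2 2!big_ord_recr /= IH.
rewrite [in RHS]big_ord_recr [X in _ = _ + X]big_ord_recr /= e2 [RHS]addrACA.
by rewrite -addrA [X in _ + X = _]addrC.
Qed.

(** In the full convolution, an index above [p] kills the factor from [P], and an index below
    [p - k] pushes the one from [Q] beyond [t]. *)
Lemma coefM_top (P Q : {poly rat}) p t k :
  (size P <= p.+1)%N -> (size Q <= t.+1)%N -> (k <= p)%N -> (k <= t)%N ->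
  (P * Q)`_(p + t - k) = \sum_(i < k.+1) P`_(p - i) * Q`_(t - (k - i)).
Proof.
move=> sP sQ kp kt; rewrite coefM.
rewrite -(big_mkord xpredT (fun j => P`_j * Q`_(p + t - k - j))).
rewrite (@big_cat_nat _ _ _ p.+1) //=; last by lia.
rewrite [X in _ + X]big_nat_cond [X in _ + X]big1 ?addr0; last first.
  by move=> j /andP[/andP[pj _] _]; rewrite (nth_default 0 (leq_trans sP pj)) mul0r.
rewrite (@big_cat_nat _ _ _ (p - k)) //=; last by lia.
rewrite big_nat_cond big1 ?add0r; last first.
  move=> j /andP[/andP[_ jk] _]; rewrite [Q`__]nth_default ?mulr0 //.
  by apply: (leq_trans sQ); lia.
rewrite -{1}[(p - k)%N]add0n big_addn big_nat_rev /= big_mkord.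
rewrite (_ : (p.+1 - (p - k))%N = k.+1); last by lia.
apply: eq_bigr => i _; have := ltn_ord i => ik.
by congr (P`_ _ * Q`_ _); lia.
Qed.

Lemma coef_bernoulli_poly m i :
  (i <= m)%N -> (bernoulli_poly m)`_(m - i) = 'C(m, i)%:R * bernoulli i.
Proof.
move=> le_im; rewrite coef_sum (bigD1 (Ordinal (le_im : i < m.+1)%N)) //=.
rewrite coefZ coefXn eqxx mulr1 big1 ?addr0 // => j /eqP ne_ji.
rewrite coefZ coefXn (_ : (_ == _) = false) ?mulr0 //; apply/eqP => e.
by apply: ne_ji; apply/val_inj => /=; have := ltn_ord j; lia.
Qed.

Lemma size_bernoulli_poly m : (size (bernoulli_poly m) <= m.+1)%N.
Proof.
apply: (leq_trans (size_sum _ _ _)); apply/bigmax_leqP => i _.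
by rewrite (leq_trans (size_scale_leq _ _)) // size_polyXn ltnS leq_subr.
Qed.

(** * Nielsen's formula and its coefficients *)

(** The range is extended to [p + t], with vanishing binomials beyond [t], so that the terms of
    Nielsen's formula can be compared over one common range. *)
Lemma expM_bernoulli_poly p t x :
  x ^+ p * (bernoulli_poly t).[x]
    = \sum_(i < (p + t).+1) 'C(t, i)%:R * bernoulli i * x ^+ (p + t - i).
Proof.
rewrite horner_sum mulr_sumr.
rewrite -[RHS](big_mkord xpredT
  (fun i => 'C(t, i)%:R * bernoulli i * x ^+ (p + t - i))).
rewrite (@big_cat_nat _ _ _ t.+1) //=; last by rewrite ltnS leq_addl.
rewrite big_mkord [X in _ + X]big_nat_cond [X in _ + X]big1 ?addr0; last first.
  by move=> i /andP[/andP[ti _] _]; rewrite bin_small // !mul0r.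
apply: eq_bigr => i _; rewrite hornerZ hornerXn mulrCA -exprD addnBA //.
by rewrite -ltnS.
Qed.

(* [bernoulli] with the value at [1] replaced by [0]. *)
Definition bernoulli_even (m : nat) : rat := bernoulli m + (m == 1%N)%:R / 2.

Lemma bernoulli_even_odd m : odd m -> bernoulli_even m = 0.
Proof.
rewrite /bernoulli_even; case: eqVneq => [->|ne1 /bernoulli_odd->//].
  by rewrite bernoulli1 mul1r addNr.
Qed.

Lemma bernoulli_even_double m : bernoulli_even (2 * m) = bernoulli (2 * m).
Proof.
by rewrite /bernoulli_even (_ : (_ == _) = false) ?mul0r ?addr0 //; lia.
Qed.

Definition nielsen_coef (p t i : nat) : rat :=
  (p%:R * 'C(t, i)%:R + t%:R * 'C(p, i)%:R) * bernoulli_even i.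

(** The product has increment [p x^(p-1) B_t(x) + t x^(t-1) B_p(x) + p t x^(p+t-2)], while
    [B_k(x) / k] has increment [x^(k-1)]. Equal increments leave a periodic difference, which is the
    constant [c]. *)
Lemma nielsen p t : (0 < p)%N -> (0 < t)%N ->
  exists c : rat,
    bernoulli_poly p * bernoulli_poly t
    = \sum_(i < p + t)
        (nielsen_coef p t i / (p + t - i)%N%:R) *: bernoulli_poly (p + t - i)
      + c%:P.
Proof.
case: p => // p; case: t => // t _ _.
set S := \sum_(i < _) _.
suff/poly_periodic e : forall x,
    (bernoulli_poly p.+1 * bernoulli_poly t.+1 - S).[x + 1]
    = (bernoulli_poly p.+1 * bernoulli_poly t.+1 - S).[x].
  by exists (bernoulli_poly p.+1 * bernoulli_poly t.+1 - S).[0]; rewrite -e addrC subrK.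
move=> x; rewrite !hornerD !hornerN !hornerM !bernoulli_polyD1 /=.
rewrite /S 2!(horner_sum _ _ (fun i : 'I_(p.+1 + t.+1) => _ *: _)).
have -> : \sum_(i < p.+1 + t.+1)
    ((nielsen_coef p.+1 t.+1 i / (p.+1 + t.+1 - i)%N%:R) *:
       bernoulli_poly (p.+1 + t.+1 - i)).[x + 1]
  = \sum_(i < p.+1 + t.+1)
    ((nielsen_coef p.+1 t.+1 i / (p.+1 + t.+1 - i)%N%:R) *:
       bernoulli_poly (p.+1 + t.+1 - i)).[x]
  + (p.+1%:R * (x ^+ p * (bernoulli_poly t.+1).[x])
     + t.+1%:R * (x ^+ t * (bernoulli_poly p.+1).[x])
     + p.+1%:R * t.+1%:R * (x ^+ p * x ^+ t)); last by ring.
rewrite !expM_bernoulli_poly !addSn !addnS [(t + p)%N]addnC.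
(* The cross term of the product absorbs the contribution of [B_1 = -1/2]. *)
have -> : p.+1%:R * t.+1%:R * (x ^+ p * x ^+ t)
   = \sum_(i < (p + t).+2) (p.+1%:R * 'C(t.+1, i)%:R + t.+1%:R * 'C(p.+1, i)%:R)
        * ((i == 1 :> nat)%:R / 2) * x ^+ ((p + t).+1 - i).
  rewrite big_ord_recl big_ord_recl big1 => [|i _]; last by rewrite mul0r mulr0 mul0r.
  rewrite /= !bin1 subSS !subn0 mul0r mulr0 mul0r exprD; lra.
rewrite !mulr_sumr -!big_split /=; apply: eq_bigr => i _.
rewrite !hornerZ bernoulli_polyD1 /nielsen_coef /bernoulli_even.
have nz : ((p + t).+2 - i)%N%:R != 0 :> rat by rewrite pnatr_eq0; have := ltn_ord i; lia.
rewrite (_ : ((p + t).+2 - i).-1 = (p + t).+1 - i)%N; last by lia.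
by field.
Qed.

(** The bounds on [N] keep every subtraction exact and the exponent [p + t - 2 * N] positive, so
    that the unknown constant of Nielsen's formula does not contribute. *)
Lemma nielsen_coefficients p t N : (2 * N < p)%N -> (2 * N < t)%N ->
  (p + t - 2 * N)%N%:R
    * ((N == 1)%:R * (p%:R * t%:R / 4)
       + \sum_(i < N.+1) ('C(p, 2 * i)%:R * bernoulli (2 * i))
           * ('C(t, 2 * (N - i))%:R * bernoulli (2 * (N - i))))
  = \sum_(j < N.+1) (p%:R * 'C(t, 2 * j)%:R + t%:R * 'C(p, 2 * j)%:R)
      * bernoulli (2 * j)
      * ('C((p + t - 2 * j).-1, 2 * (N - j))%:R * bernoulli (2 * (N - j))).
Proof.
move=> Np Nt; have [||c] := @nielsen p t; [lia..|].
move=> /(congr1 (fun P : {poly rat} => P`_(p + t - 2 * N))).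
rewrite (coefM_top _ _ _ _ _ (size_bernoulli_poly p) (size_bernoulli_poly t)); [|lia..].
rewrite coefD coefC (_ : (_ == 0)%N = false) ?addr0; last by lia.
pose F i : rat := 'C(p, i)%:R * bernoulli i * ('C(t, 2 * N - i)%:R * bernoulli (2 * N - i)).
rewrite (eq_bigr (fun i : 'I_(2 * N).+1 => F i)) => [|i _]; last first.
  by have := ltn_ord i => iN; rewrite !coef_bernoulli_poly //; lia.
rewrite (big_ord_parity _ F) coef_sum.
(* Two odd indices with sum [2 * N] give a nonzero product only if both are 1; this happens for
   [N = 1] and yields [(-p/2)(-t/2)]. *)
have -> : \sum_(i < N) F (2 * i).+1 = (N == 1)%:R * (p%:R * t%:R / 4).
  case: eqVneq => [N1|N1]; rewrite ?mul1r ?mul0r.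
    by rewrite /F N1 big_ord1 muln0 (_ : (2 * 1 - 1)%N = 1%N) // !bin1 bernoulli1; lra.
  apply: big1 => i _; rewrite /F; have := ltn_ord i => iN.
  have [->|i0] := posnP i.
    by rewrite (@bernoulli_odd (2 * N - _)) ?mulr0 //; lia.
  by rewrite (@bernoulli_odd _.+1) ?(mulr0, mul0r) //; lia.
pose G i : rat := ((nielsen_coef p t i / (p + t - i)%N%:R)
   *: bernoulli_poly (p + t - i))`_(p + t - 2 * N).
rewrite -(big_mkord xpredT G).
rewrite (@big_cat_nat _ _ _ (2 * N).+1) //=; last by lia.
(* For [i > 2 * N] the polynomial has degree below the extracted exponent. *)
rewrite [X in _ = _ + X]big_nat_cond [X in _ = _ + X]big1 ?addr0; last first.
  move=> i /andP[/andP[Ni _] _]; rewrite /G coefZ nth_default ?mulr0 //.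
  by rewrite (leq_trans (size_bernoulli_poly _)) //; lia.
rewrite big_mkord (big_ord_parity _ G) [X in _ = _ + X]big1 ?addr0; last first.
  move=> i _; rewrite /G coefZ /nielsen_coef bernoulli_even_odd ?mulr0 ?mul0r //=.
  by lia.
rewrite addrC => e.
rewrite (_ : \sum_(i < N.+1) _ = \sum_(i < N.+1) F (2 * i)%N); last first.
  by apply: eq_bigr => i _; rewrite /F mulnBr.
rewrite e mulr_sumr; apply: eq_bigr => i _; have := ltn_ord i => iN.
rewrite /G coefZ (_ : (p + t - 2 * N)%N = (p + t - 2 * i - 2 * (N - i))%N); last by lia.
rewrite coef_bernoulli_poly; last by lia.
rewrite /nielsen_coef bernoulli_even_double.
have nz : (p + t - 2 * i)%N%:R != 0 :> rat by rewrite pnatr_eq0; lia.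
(* Absorption [m C(m-1, k) = (m-k) C(m, k)] with [m = p + t - 2 * i] and [k = 2 * (N - i)] trades
   the denominator [m] for the prefactor [p + t - 2 * N]. *)
apply: (mulfI nz); rewrite [RHS]mulrCA [X in _ = _ * X]mulrA.
rewrite -[X in _ = _ * (X * _)]natrM mul_bin_down natrM.
by field.
Qed.

(** * Generalized binomial coefficients *)

Definition gbin (x : rat) (k : nat) : rat :=
  \prod_(i < k) (x - i%:R) / k`!%:R.

Lemma gbin_nat n k : gbin n%:R k = 'C(n, k)%:R.
Proof.
have nz : k`!%:R != 0 :> rat by rewrite pnatr_eq0 -lt0n fact_gt0.
apply: (mulIf nz); rewrite divfK // -natrM bin_ffact.
elim: k {nz} => [|k IH]; first by rewrite big_ord0.
rewrite big_ord_recr /= IH ffactnSr natrM.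
by have [/natrB->//|/ffact_small->] := leqP k n; rewrite !mul0r.
Qed.

(** The reflection reverses the order of the [k] factors and negates each; an even number of signs
    cancels. *)
Lemma gbin_reflect x k : ~~ odd k -> gbin (k%:R - 1 - x) k = gbin x k.
Proof.
move=> even_k; rewrite /gbin (reindex_inj rev_ord_inj) /=; congr (_ / _).
rewrite (eq_bigr (fun i : 'I_k => - (x - i%:R))) => [|i _].
  by rewrite prodrN card_ord -signr_odd (negbTE even_k) mul1r.
by rewrite natrB ?ltn_ord // -natr1; ring.
Qed.

(** Both sides are [x (x-1) ... (x-k) / k!]. *)
Lemma gbin_shift x k : (x - k%:R) * gbin x k = x * gbin (x - 1) k.
Proof.
rewrite /gbin !mulrA; congr (_ / _).
rewrite mulrC -(big_ord_recr k (fun i => x - i%:R)) big_ord_recl subr0.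
by congr (_ * _); apply: eq_bigr => i _; rewrite /= /bump add1n -natr1; ring.
Qed.

(** The shift identity followed by reflection at [x - 1]. This is what links the two branches of
    [bq]. *)
Lemma gbin_even_div x k : ~~ odd k -> x != 0 -> x - k%:R != 0 ->
  gbin x k / x = gbin (k%:R - x) k / (x - k%:R).
Proof.
move=> even_k x0 xk0; have := gbin_shift x k.
rewrite -(gbin_reflect (x - 1)) // (_ : k%:R - 1 - (x - 1) = k%:R - x); last by ring.
by move=> e; apply/eqP; rewrite eqr_div // [_ * x]mulrC -e mulrC.
Qed.

(** * Polynomial functions, to pass from large naturals to all rationals *)

Definition polyfun (f : rat -> rat) := exists P : {poly rat}, forall x, f x = P.[x].

Lemma polyfun_cst c : polyfun (fun=> c).
Proof. by exists c%:P => x; rewrite hornerC. Qed.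

Lemma polyfun_id : polyfun id.
Proof. by exists 'X => x; rewrite hornerX. Qed.

Lemma polyfunD f g : polyfun f -> polyfun g -> polyfun (fun x => f x + g x).
Proof. by move=> [P fP] [Q gQ]; exists (P + Q) => x; rewrite hornerD fP gQ. Qed.

Lemma polyfunN f : polyfun f -> polyfun (fun x => - f x).
Proof. by move=> [P fP]; exists (- P) => x; rewrite hornerN fP. Qed.

Lemma polyfunM f g : polyfun f -> polyfun g -> polyfun (fun x => f x * g x).
Proof. by move=> [P fP] [Q gQ]; exists (P * Q) => x; rewrite hornerM fP gQ. Qed.

Lemma polyfun_sum n (F : 'I_n -> rat -> rat) :
  (forall i, polyfun (F i)) -> polyfun (fun x => \sum_i F i x).
Proof.
elim: n F => [|n IH] F pF.
  by exists 0 => x; rewrite horner0 big_ord0.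
have [P FP] := polyfunD _ _ (IH _ (fun i => pF (widen_ord (leqnSn n) i))) (pF ord_max).
by exists P => x; rewrite -FP big_ord_recr.
Qed.

Lemma polyfun_gbin k f : polyfun f -> polyfun (fun x => gbin (f x) k).
Proof.
move=> [P fP]; exists ((\prod_(i < k) (P - i%:R%:P)) * k`!%:R^-1%:P) => x.
rewrite hornerM hornerC horner_prod; congr (_ * _).
by apply: eq_bigr => i _; rewrite hornerD hornerN hornerC fP.
Qed.

Lemma polyfun_eq f g n0 : polyfun f -> polyfun g ->
  (forall n, (n0 <= n)%N -> f n%:R = g n%:R) -> f =1 g.
Proof.
move=> [P fP] [Q gQ] fg x; apply/eqP; rewrite fP gQ -subr_eq0 -hornerN -hornerD.
rewrite (@poly_eq0_nat (P - Q) n0) ?horner0 // => n /fg.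
by rewrite fP gQ hornerD hornerN => ->; rewrite subrr.
Qed.

Ltac polyfun := repeat first
  [ exact: polyfun_cst | exact: polyfun_id | apply: polyfun_gbin
  | apply: polyfunD | apply: polyfunN | apply: polyfunM
  | apply: polyfun_sum => ? ].

(** Both sides are polynomial in each variable, so naturals above [2 * N] suffice, first for [x] and
    then for [y]. *)
Lemma bernoulli_convolution N (x y : rat) :
  (x + y - (2 * N)%N%:R)
    * ((N == 1)%:R * (x * y / 4)
       + \sum_(i < N.+1) (gbin x (2 * i) * bernoulli (2 * i))
           * (gbin y (2 * (N - i)) * bernoulli (2 * (N - i))))
  = \sum_(j < N.+1) (x * gbin y (2 * j) + y * gbin x (2 * j))
      * bernoulli (2 * j)
      * (gbin ((2 * N)%N%:R - x - y) (2 * (N - j)) * bernoulli (2 * (N - j))).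
Proof.
move: x; apply: (@polyfun_eq _ _ (2 * N).+1); [by polyfun..|move=> p Np].
move: y; apply: (@polyfun_eq _ _ (2 * N).+1); [by polyfun..|move=> t Nt].
rewrite -natrD -natrB; last by lia.
have := nielsen_coefficients p t N Np Nt.
under eq_bigr do rewrite -!gbin_nat.
move=> ->; apply: eq_bigr => j _; have jN := ltn_ord j.
(* Reflection turns the upper argument [p + t - 2 * j - 1] into [2 * N - p - t], which no longer
   depends on [j]. *)
rewrite -!gbin_nat -[X in _ * (X * _) = _]gbin_reflect ?oddM //.
congr (_ * (gbin _ _ * _)).
have -> : (p + t - 2 * j).-1%:R = p%:R + t%:R - (2 * j)%N%:R - 1 :> rat.
  by rewrite -subn1 natrB ?natrB ?natrD //; lia.
rewrite mulnBr natrB; last by lia.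
by ring.
Qed.

(** * The numbers [bq] in terms of [gbin] *)

Lemma gbin_double_swap (q : int) (n i : nat) :
    (i <= n)%N -> 2 * n%:Z + q != 0 -> 2 * i%:Z + q != 0 ->
  2 / (2 * n%:Z + q)%:~R * gbin (2 * n%:Z + q)%:~R (2 * (n - i))
    = 2 / (2 * i%:Z + q)%:~R * gbin (- (2 * i%:Z + q)%:~R) (2 * (n - i)).
Proof.
move=> le_in nz iz.
have iq : (2 * n%:Z + q)%:~R - (2 * (n - i))%N%:R = (2 * i%:Z + q)%:~R :> rat.
  by rewrite [(2 * (n - i))%N%:R]pmulrn -rmorphB; congr (_%:~R); lia.
rewrite mulrAC -mulrA gbin_even_div ?iq ?intr_eq0 ?oddM //.
by rewrite -opprB iq mulrA mulrAC.
Qed.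

(** Binomial symmetry settles the first branch, and [gbin_double_swap] carries the second one to the
    same formula. The case [2 * i + q = 0] is allowed: it can occur for [q = r + s]. *)
Lemma bq_double (q : int) (n i : nat) : (i <= n)%N -> 2 * n%:Z + q != 0 ->
  bq q n%:Z i%:Z = 2 / (2 * n%:Z + q)%:~R
    * gbin (2 * n%:Z + q)%:~R (2 * (n - i)) * bernoulli (2 * (n - i)).
Proof.
move=> le_in nz; rewrite /bq ltz_nat ltnNge le_in /=.
rewrite (_ : `|n%:Z - i%:Z|%N = (n - i)%N); last by lia.
have [pos|neg] := ltrP 0 (2 * n%:Z + q).
  rewrite ifT; last by lia.
  have [X eX] : exists X : nat, 2 * n%:Z + q = X%:Z by exists (absz (2 * n%:Z + q)); lia.
  rewrite eX -pmulrn gbin_nat /binz; congr (_ * _ * _).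
  have [iq|iq] := boolP (0 <= 2 * i%:Z + q).
    rewrite /= -bin_sub; last by lia.
    by congr ('C(_, _)%:R); lia.
  (* With [2 * i + q < 0] the left binomial is 0 by convention, and the right one is 0 because
     [2 * (n - i)] exceeds [2 * n + q]. *)
  by rewrite /= bin_small //; lia.
rewrite ifF; last by lia.
rewrite ifT; last by lia.
rewrite gbin_double_swap //; last by lia.
have [Y eY] : exists Y : nat, - (2 * i%:Z + q) = Y%:Z by exists (absz (2 * i%:Z + q)); lia.
rewrite -mulrNz eY -pmulrn gbin_nat /binz; congr (_ * _ * _).
rewrite ifT; last by lia.
rewrite -[in RHS]bin_sub; last by lia.
by congr ('C(_, _)%:R); lia.
Qed.

(** Here the argument of [gbin] depends only on the lower index, so it stays fixed while the upper
    index runs through a sum. *)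
Lemma bq_double_low (q : int) (n i : nat) :
    (i <= n)%N -> 2 * n%:Z + q != 0 -> 2 * i%:Z + q != 0 ->
  bq q n%:Z i%:Z = 2 / (2 * i%:Z + q)%:~R
    * gbin (- (2 * i%:Z + q)%:~R) (2 * (n - i)) * bernoulli (2 * (n - i)).
Proof. by move=> le_in nz iz; rewrite bq_double // gbin_double_swap. Qed.

Lemma bq_lt (q n i : int) : n < i -> bq q n i = 0.
Proof. by move=> lt_ni; rewrite /bq lt_ni orbT. Qed.

Lemma double_neq0 (q : int) (n : nat) :
  (0 < q) \/ ~~ (2 %| q)%Z -> 2 * n%:Z + q != 0.
Proof. by case; lia. Qed.

Lemma big_nat_shift (R : nmodType) (F : nat -> R) m k :
  \sum_(m <= i < k + m) F i = \sum_(i < k) F (i + m)%N.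
Proof. by rewrite -{1}[m]add0n big_addn addnK big_mkord. Qed.

Theorem theorem6p2 (r s : int) (n alpha beta : nat)
  (hr : (0 < r) \/ ~~ (2 %| r)%Z)
  (hs : (0 < s) \/ ~~ (2 %| s)%Z)
  (hn : 2 * (n%:Z) + r + s != 0)
  (ha : (alpha <= n)%N) (hb : (beta <= n)%N) :
  ((alpha + beta).+1 == n)%:R
    + \sum_(alpha <= l < (n - beta).+1)
        bq r l%:Z alpha%:Z * bq s (n - l)%N%:Z beta%:Z
  = \sum_(k < n.+1)
      bq (r + s) n%:Z k%:Z
        * (bq r (k%:Z - beta%:Z) alpha%:Z + bq s (k%:Z - alpha%:Z) beta%:Z).
Proof.
pose F k := bq (r + s) n%:Z k%:Z
  * (bq r (k%:Z - beta%:Z) alpha%:Z + bq s (k%:Z - alpha%:Z) beta%:Z).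
have F0 k : (k < alpha + beta)%N -> F k = 0.
  by move=> lt_k; rewrite /F [bq r _ _]bq_lt ?[bq s _ _]bq_lt ?addr0 ?mulr0 //; lia.
(* If [n < alpha + beta], the delta and both sums vanish. *)
have [lt_n|le_n] := ltnP n (alpha + beta).
  rewrite big_geq; last by lia.
  rewrite big1 => [|k _]; last by apply: F0; have := ltn_ord k; lia.
  by rewrite (_ : (_ == n) = false) ?addr0 //; lia.
have [N eN] : exists N, n = (N + (alpha + beta))%N.
  by exists (n - (alpha + beta))%N; lia.
rewrite -(big_mkord xpredT F) [RHS](@big_cat_nat _ _ _ (alpha + beta)) //=; last by lia.
rewrite [X in _ = X + _]big_nat_cond [X in _ = X + _]big1 ?add0r; last first.
  by move=> k /andP[/andP[_ /F0]].
rewrite (_ : (n - beta).+1 = N.+1 + alpha)%N; last by lia.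
rewrite [in RHS](_ : n.+1 = N.+1 + (alpha + beta))%N; last by lia.
rewrite !big_nat_shift.
rewrite (_ : ((alpha + beta).+1 == n) = (N == 1)); last by lia.
pose x : rat := - (2 * alpha%:Z + r)%:~R; pose y : rat := - (2 * beta%:Z + s)%:~R.
(* [S] is the argument of [gbin] in [b_{r+s}(n,k)] for every [k]; [hn] makes it nonzero. *)
pose S : rat := (2 * n%:Z + (r + s))%:~R.
have S0 : S != 0 by rewrite intr_eq0 addrA.
have x0 : x != 0 by rewrite oppr_eq0 intr_eq0 double_neq0.
have y0 : y != 0 by rewrite oppr_eq0 intr_eq0 double_neq0.
have eS : S = (2 * N)%N%:R - x - y.
  by rewrite /S /x /y !opprK [(2 * N)%N%:R]pmulrn -!rmorphD; congr (_%:~R); lia.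
pose g i := gbin x (2 * i) * bernoulli (2 * i).
pose h i := gbin y (2 * i) * bernoulli (2 * i).
have bg i : bq r (i + alpha)%N%:Z alpha%:Z = - 2 / x * g i.
  rewrite bq_double_low ?double_neq0 ?leq_addl // addnK /g -/x /x -mulrA.
  by rewrite invrN mulrNN.
have bh i : bq s (i + beta)%N%:Z beta%:Z = - 2 / y * h i.
  rewrite bq_double_low ?double_neq0 ?leq_addl // addnK /h -/y /y -mulrA.
  by rewrite invrN mulrNN.
have eNS : x + y - (2 * N)%N%:R = - S by rewrite eS; ring.
pose T := \sum_(i < N.+1) g i * h (N - i)%N.
pose U := \sum_(j < N.+1) (x * h j + y * g j)
  * (gbin S (2 * (N - j)) * bernoulli (2 * (N - j))).
have e : - S * ((N == 1)%:R * (x * y / 4) + T) = U.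
  rewrite -eNS bernoulli_convolution -eS; apply: eq_bigr => j _.
  by rewrite /g /h; ring.
have bS j : (j <= N)%N -> bq (r + s) n%:Z (j + (alpha + beta))%N%:Z
    = 2 / S * gbin S (2 * (N - j)) * bernoulli (2 * (N - j)).
  move=> jN; rewrite bq_double ?addrA //; last by lia.
  by rewrite -addrA -/S (_ : (n - _)%N = (N - j)%N); last by lia.
clearbody x y S.
(* The constant is [(-2/x)(-2/y)]. *)
rewrite (_ : \sum_(i < _) _ = 4 / (x * y) * T); last first.
  rewrite mulr_sumr; apply: eq_bigr => i _; have := ltn_ord i => iN.
  rewrite (_ : (n - (i + alpha))%N = (N - i + beta)%N) ?bg ?bh; last by lia.
  by field; rewrite ?x0 ?y0.
(* The constant comes from [(2/S)(-2 g/x - 2 h/y)] over the common denominator [S x y]. *)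
rewrite [RHS](_ : _ = - 4 / (S * x * y) * U); last first.
  rewrite mulr_sumr; apply: eq_bigr => j _; have := ltn_ord j => jN.
  rewrite /F bS //.
  rewrite (_ : (j + (alpha + beta))%N%:Z - beta%:Z = (j + alpha)%N%:Z); last by lia.
  rewrite (_ : (j + (alpha + beta))%N%:Z - alpha%:Z = (j + beta)%N%:Z); last by lia.
  rewrite bg bh.
  by field; rewrite ?x0 ?y0 ?S0.
by rewrite -e; field; rewrite ?x0 ?y0 ?S0.
Qed.
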